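(* Let $\mathbb{D}$, $\mathbb{C}$, $\mathbb{L}$ and $\mathbb{S}$ denote the collections of DAG models, CStree models, LDAG models and (stratified) staged tree models, respectively, each ranging over all vectors $\mathbf{X}=(X_1,\ldots,X_p)$ of finitely many categorical variables. Then $$\mathbb{D}\subsetneq\mathbb{C}\subsetneq\mathbb{L}\subsetneq\mathbb{S}.$$
   Context: Setting. $[p]=\{1,\ldots,p\}$. $\mathbf{X}=(X_1,\ldots,X_p)$ is a vector of jointly distributed categorical variables, $X_i$ has state space $\mathcal{X}_i=[d_i]$ with $d_i>1$, $\mathcal{X}=\prod_{i=1}^p\mathcal{X}_i$; for $S\subseteq[p]$, $\mathbf{X}_S=(X_i)_{i\in S}$ has state space $\mathcal{X}_S$ ($\mathcal{X}_\emptyset$ is a one-point set). Distributions are strictly positive, and we identify $\mathbf{X}$ with its joint distribution. A model is a set of such distributions on a fixed $\mathcal{X}$. For an ordering $\pi=\pi_1\cdots\pi_p$ of $[p]$, $[\pi_1:\pi_{i-1}]=\{\pi_1,\ldots,\pi_{i-1}\}$ and $\mathcal{X}_{\pi_1:\pi_{i-1}}=\mathcal{X}_{[\pi_1:\pi_{i-1}]}$. CSI relations. For disjoint $A,B,C,S\subseteq[p]$ and $\mathbf{x}_S\in\mathcal{X}_S$, the context-specific conditional independence (CSI) relation $\mathbf{X}_A\perp\mathbf{X}_B\mid\mathbf{X}_C,\mathbf{X}_S=\mathbf{x}_S$ means $P(\mathbf{x}_A\mid\mathbf{x}_B,\mathbf{x}_C,\mathbf{x}_S)=P(\mathbf{x}_A\mid\mathbf{x}_C,\mathbf{x}_S)$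 for all $\mathbf{x}_A,\mathbf{x}_B,\mathbf{x}_C$. DAG model. For a DAG $\mathcal{G}=([p],E)$ with parent sets $\mathrm{pa}_{\mathcal{G}}(i)$, $\mathcal{M}(\mathcal{G})$ is the set of all $\mathbf{X}$ with $P(\mathbf{x})=\prod_{i=1}^pP(x_i\mid\mathbf{x}_{\mathrm{pa}_{\mathcal{G}}(i)})$ for all $\mathbf{x}\in\mathcal{X}$. CStree model. For an ordering $\pi$, $i\in[p]$, $S\subseteq[\pi_1:\pi_{i-1}]$ and $\mathbf{x}_S\in\mathcal{X}_S$, let $\mathcal{S}_{\pi,i}(\mathbf{x}_S)$ be the set of all outcomes in $\mathcal{X}_{\pi_1:\pi_{i-1}}$ that agree with $\mathbf{x}_S$ in the coordinates $S$. A CStree is a pair $\mathcal{T}=(\pi,\mathbf{s})$, where $\mathbf{s}=\mathbf{s}_1\cup\cdots\cup\mathbf{s}_p$ and each $\mathbf{s}_i$ is a collection of sets of the form $\mathcal{S}_{\pi,i}(\mathbf{x}_S)$ which is a partition of $\mathcal{X}_{\pi_1:\pi_{i-1}}$. The CStree model $\mathcal{M}(\mathcal{T})$ is the set of all $\mathbf{X}$ satisfying $X_{\pi_i}\perp\mathbf{X}_{[\pi_1:\pi_{i-1}]\setminus S}\mid\mathbf{X}_S=\mathbf{x}_S$ for all $i\in[p]$ and all $\mathcal{S}_{\pi,i}(\mathbf{x}_S)\in\mathbf{s}_i$. LDAG model. An LDAG is a pair $(\mathcal{G},\mathcal{L})$ where $\mathcal{G}=([p],E)$ is a DAG and $\mathcal{L}$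 consists of a (possibly empty) label $L_{j,i}\subseteq\mathcal{X}_{\mathrm{pa}_{\mathcal{G}}(i)\setminus j}$ for each edge $j\to i\in E$. Its model $\mathcal{M}(\mathcal{G},\mathcal{L})$ is the set of all $\mathbf{X}\in\mathcal{M}(\mathcal{G})$ satisfying $X_i\perp X_j\mid\mathbf{X}_{\mathrm{pa}_{\mathcal{G}}(i)\setminus j}=\mathbf{x}_{\mathrm{pa}_{\mathcal{G}}(i)\setminus j}$ for all $\mathbf{x}_{\mathrm{pa}_{\mathcal{G}}(i)\setminus j}\in L_{j,i}$ and all $j\to i\in E$. (Stratified) staged tree model. A staged tree is a pair $(\pi,\mathbf{s})$, where $\pi$ is an ordering of $[p]$ and $\mathbf{s}=\mathbf{s}_1\cup\cdots\cup\mathbf{s}_p$ with each $\mathbf{s}_i$ an arbitrary partition of $\mathcal{X}_{\pi_1:\pi_{i-1}}$ (its blocks are called stages). Its model is the set of all $\mathbf{X}$ such that, for every $i$, $P(X_{\pi_i}\mid\mathbf{X}_{\pi_1:\pi_{i-1}}=\mathbf{y})=P(X_{\pi_i}\mid\mathbf{X}_{\pi_1:\pi_{i-1}}=\mathbf{y}')$ whenever $\mathbf{y},\mathbf{y}'$ lie in the same block of $\mathbf{s}_i$. *)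

(* Defs.v *)
From mathcomp Require Import all_boot all_algebra.
From mathcomp Require Import perm.
From mathcomp Require Import classical_sets reals.

Set Implicit Arguments.
Unset Strict Implicit.
Unset Printing Implicit Defensive.

Import GRing.Theory.
Local Open Scope ring_scope.

(* The index set [p] = {1, ..., p} is 'I_p and the state space [d_i] of X_i is
   'I_(d i), both numbered from 0. *)
Record vars := Vars {
  nvars : nat;
  card_state : 'I_nvars -> nat;
  card_state_gt1 : forall i, (1 < card_state i)%N }.

Section StateSpace.
Variable V : vars.

Definition var := 'I_(nvars V).

Definition outcome := {dffun forall i : var, 'I_(card_state i)}.

Definition suboutcome (S : {set var}) :=
  {dffun forall i : {i : var | i \in S}, 'I_(card_state (val i))}.

Definition restr (S : {set var}) (x : outcome) : suboutcome S :=
  [ffun i : {i : var | i \in S} => x (val i)].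

(* The entries [y i] and [z j] have types 'I_(card_state (val i)) and
   'I_(card_state (val j)), hence the comparison in nat. *)
Definition agree (T S : {set var}) (y : suboutcome T) (z : suboutcome S) :=
  [forall i, forall j, (val i == val j) ==> (y i == z j :> nat)].

End StateSpace.

Section Distributions.
Variables (R : realType) (V : vars).

Record dist := Dist {
  prob :> outcome V -> R;
  prob_gt0 : forall x, 0 < prob x;
  prob_sum1 : \sum_x prob x = 1 }.

(* P(x_S); only the coordinates of [x] in [S] matter. *)
Definition marg (P : dist) (S : {set var V}) (x : outcome V) : R :=
  \sum_(z : outcome V | restr S z == restr S x) P z.

(* P(x_A | x_B) *)
Definition cond (P : dist) (A B : {set var V}) (x : outcome V) : R :=
  marg P (A :|: B) x / marg P B x.

(* X_A _|_ X_B | X_C, X_S = x_S, for disjoint A, B, C, S. As every state space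
   is nonempty, quantifying over the full outcomes [x] extending [xS] amounts
   to quantifying over all x_A, x_B, x_C. *)
Definition CSI (P : dist) (A B C S : {set var V}) (xS : suboutcome S) : Prop :=
  forall x : outcome V, restr S x = xS ->
    cond P A (B :|: C :|: S) x = cond P A (C :|: S) x.

End Distributions.

Section Graphs.
Variable V : vars.

(* [cycle edge c] says that [c] is a closed directed walk; it holds vacuously
   for the empty sequence, and [cycle edge [:: i]] is a loop at [i]. *)
Record dag := Dag {
  edge : rel (var V);
  dag_acyclic : forall c : seq (var V), cycle edge c -> c = [::] }.

Definition pa (G : dag) (i : var V) : {set var V} := [set j | edge G j i].

Record ldag := LDag {
  ldag_dag :> dag;
  label : forall j i : var V,
    edge ldag_dag j i -> {set suboutcome (pa ldag_dag i :\ j)} }.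

End Graphs.

Section Trees.
Variable V : vars.

(* An ordering is a permutation [pi], listing the variables as pi 0, pi 1, ...;
   [before pi k] is the set of the variables listed before [pi k]. *)
Definition before (pi : {perm var V}) (k : 'I_(nvars V)) : {set var V} :=
  [set pi j | j : 'I_(nvars V) & (j < k)%N].

Record stagedTree := StagedTree {
  st_order : {perm var V};
  stages : forall k, {set {set suboutcome (before st_order k)}};
  stages_partition : forall k,
    finset.partition (stages k) [set: suboutcome (before st_order k)] }.

(* The set S_{pi,k}(x_S). *)
Definition stage (pi : {perm var V}) (k : 'I_(nvars V)) (S : {set var V})
    (xS : suboutcome S) : {set suboutcome (before pi k)} :=
  [set y | agree y xS].

Record csTree := CSTree {
  cst_tree :> stagedTree;
  cst_stages : forall k B, B \in stages cst_tree k ->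
    exists (S : {set var V}) (xS : suboutcome S),
      S \subset before (st_order cst_tree) k /\
      B = stage (st_order cst_tree) k xS }.

End Trees.

Section Models.
Variables (R : realType) (V : vars).
Local Open Scope classical_set_scope.

Definition dag_model (G : dag V) : set (dist R V) :=
  [set P : dist R V | forall x, P x = \prod_i cond P [set i]%SET (pa G i) x].

Definition ldag_model (G : ldag V) : set (dist R V) :=
  [set P : dist R V | dag_model G P /\
    forall (j i : var V) (e : edge G j i) (xS : suboutcome (pa G i :\ j)%SET),
      xS \in label e -> CSI P [set i]%SET [set j]%SET finset.set0 xS].

Definition csTree_model (T : csTree V) : set (dist R V) :=
  [set P : dist R V | forall k (S : {set var V}) (xS : suboutcome S),
    S \subset before (st_order T) k ->
    stage (st_order T) k xS \in stages T k ->
    CSI P [set st_order T k]%SET (before (st_order T) k :\: S)%SET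
      finset.set0 xS].

Definition stagedTree_model (T : stagedTree V) : set (dist R V) :=
  [set P : dist R V | forall k B, B \in stages T k ->
    forall x x' : outcome V,
      restr (before (st_order T) k) x \in B ->
      restr (before (st_order T) k) x' \in B ->
      x (st_order T k) = x' (st_order T k) ->
      cond P [set st_order T k]%SET (before (st_order T) k) x =
      cond P [set st_order T k]%SET (before (st_order T) k) x'].

End Models.

Section Collections.
Variable R : realType.
Local Open Scope classical_set_scope.

Record model := Model {
  model_vars : vars;
  model_dists : set (dist R model_vars) }.

Arguments model_dists : clear implicits.

Definition DAG_models : set model :=
  [set M : model | exists G : dag (model_vars M), model_dists M = dag_model G].

Definition CStree_models : set model :=
  [set M : model | exists T : csTree (model_vars M),
    model_dists M = csTree_model T].

Definition LDAG_models : set model :=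
  [set M : model | exists G : ldag (model_vars M), model_dists M = ldag_model G].

Definition stagedTree_models : set model :=
  [set M : model | exists T : stagedTree (model_vars M),
    model_dists M = stagedTree_model T].

End Collections.

Arguments DAG_models : clear implicits.
Arguments CStree_models : clear implicits.
Arguments LDAG_models : clear implicits.
Arguments stagedTree_models : clear implicits.

(* Main.v *)
(* Fix a linear extension of the graph.  Each of the four models then prescribes,
   for every variable [i], which histories (values of the variables before [i])
   give [i] the same conditional distribution: those in a cylinder for a CSI
   relation, those with the same parent values for a DAG, and those related by
   changing one parent in a labeled context for an LDAG.
   Separations.  DAG models, and LDAG models in two variables, are invariant
   under relabeling the states of a variable, while independence in the single
   context X_0 = 0, or merging two of three states of X_0, is not.  The LDAG
   which merges the histories 00, 01, 10 of X_2 is not a CStree model: if X_2 is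
   last, a cylinder containing these three histories also contains 11; if X_c
   with c <> 2 is last, a CStree model is stable under making X_c uniform and
   independent of the rest, which destroys X_2 _|_ X_b | X_c = 0. *)

Require Import Defs.
From mathcomp Require Import boolp classical_sets reals.
From mathcomp Require Import all_boot all_order all_algebra perm.
From mathcomp Require Import ring lra.

Set Implicit Arguments.
Unset Strict Implicit.
Unset Printing Implicit Defensive.

Import Order.TTheory GRing.Theory Num.Theory.
Local Open Scope ring_scope.

(** * Outcomes, their restrictions and updates of one coordinate *)

Section Outcomes.
Variable V : vars.
Implicit Types (S T : {set var V}) (x y : outcome V).

Lemma restr_eqP S x y :
  restr S x = restr S y <-> (forall i, i \in S -> x i = y i).
Proof.
split=> [eqxy i Si | eqxy]; last by apply/ffunP=> -[i Si]; rewrite !ffunE eqxy.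
by have /ffunP/(_ (exist _ i Si)) := eqxy; rewrite !ffunE.
Qed.

Lemma restr_sub S T x y :
  S \subset T -> restr T x = restr T y -> restr S x = restr S y.
Proof.
by move=> /subsetP sST /restr_eqP eqxy; apply/restr_eqP=> i /sST/eqxy.
Qed.

Lemma card_state_gt0 (i : var V) : (0 < card_state i)%N.
Proof. exact: ltnW (card_state_gt1 i). Qed.

Definition zero_outcome : outcome V :=
  [ffun i : var V => Ordinal (card_state_gt0 i)].

(** Matching on [idP] supplies the membership proof that indexes [y]; coordinates outside [S]
    default to state 0. *)
Definition extend S (y : suboutcome S) : outcome V :=
  [ffun i => if @idP (i \in S) is ReflectT Si then y (exist _ i Si)
             else zero_outcome i].

Lemma extendK S (y : suboutcome S) : restr S (extend y) = y.
Proof.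
apply/ffunP=> -[i Si]; rewrite !ffunE /=; case: {-}_ / idP => // Si'.
by rewrite (bool_irrelevance Si Si').
Qed.

Lemma extend_restr S x i : i \in S -> extend (restr S x) i = x i.
Proof. by move: i; apply/restr_eqP; rewrite extendK. Qed.

Lemma restrP S (P : suboutcome S -> Prop) :
  (forall x, P (restr S x)) -> forall s, P s.
Proof. by move=> PS s; rewrite -(extendK s). Qed.

Lemma agree_restr S T x y :
  S \subset T -> agree (restr T x) (restr S y) = (restr S x == restr S y).
Proof.
move=> /subsetP sST; apply/'forall_forallP/eqP=> [agr | /restr_eqP eqxy].
  apply/restr_eqP=> i Si; apply: val_inj; apply/eqP.
  have := agr (exist _ i (sST i Si)) (exist _ i Si).
  by rewrite !ffunE eqxx.
case=> [i Ti] [j Sj]; rewrite !ffunE /=; apply/implyP=> /eqP eqij.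
by subst j; rewrite eqxy.
Qed.

Definition update x (i : var V) (v : 'I_(card_state i)) : outcome V :=
  [ffun j => dfwith x v j].

Lemma update_same x i (v : 'I_(card_state i)) : update x v i = v.
Proof. by rewrite ffunE dfwith_in. Qed.

Lemma update_other x i (v : 'I_(card_state i)) j : j != i -> update x v j = x j.
Proof. by move=> ji; rewrite ffunE dfwith_out // eq_sym. Qed.

Lemma restr_update S x i (v : 'I_(card_state i)) :
  i \notin S -> restr S (update x v) = restr S x.
Proof.
by move=> Si; apply/restr_eqP=> j Sj; rewrite update_other // (memPn Si).
Qed.

Lemma restr_updateU S x i (v : 'I_(card_state i)) y : i \notin S ->
  (restr (i |: S) y == restr (i |: S) (update x v))
  = (y i == v) && (restr S y == restr S x).
Proof.
move=> iS; apply/eqP/andP=> [eqy | [/eqP yi /eqP/restr_eqP eqy]].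
  rewrite -(restr_update x v iS) (restr_sub (subsetUr _ _) eqy).
  by move/restr_eqP: eqy => -> //; rewrite ?setU11 // update_same.
apply/restr_eqP=> j /setU1P[-> | Sj]; first by rewrite update_same.
by rewrite update_other ?eqy // (memPn iS).
Qed.

Lemma update_val x i (v : 'I_(card_state i)) j :
  update x v j = (if j == i then nat_of_ord v else x j) :> nat.
Proof.
by case: eqP => [-> | /eqP ji]; [rewrite update_same | rewrite update_other].
Qed.

Lemma zero_outcome_val (j : var V) : zero_outcome j = 0%N :> nat.
Proof. by rewrite ffunE. Qed.

End Outcomes.

(** * Marginals and conditional probabilities *)

Section Marginals.
Variables (R : realType) (V : vars).
Implicit Types (P : dist R V) (S T : {set var V}) (x y z : outcome V).
Implicit Types (F : outcome V -> R).

(** Convertible to [marg] on a distribution, but available for any function, in particular for a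
    product of kernels not yet known to sum to 1. *)
Definition marginal F S x := \sum_(z | restr S z == restr S x) F z.

Lemma eq_marginal F S x y :
  restr S x = restr S y -> marginal F S x = marginal F S y.
Proof. by rewrite /marginal => ->. Qed.

Lemma marginal_full F x : marginal F [set: var V] x = F x.
Proof.
rewrite /marginal (big_pred1 x) // => z /=.
apply/eqP/eqP=> [/restr_eqP eqzx | -> //].
by apply/ffunP=> i; apply: eqzx; rewrite inE.
Qed.

Lemma marginal_empty F x : marginal F finset.set0 x = \sum_z F z.
Proof.
apply: eq_bigl => z; apply/eqP/restr_eqP => i; by rewrite inE.
Qed.

Lemma marginal_sum F S i x : i \notin S ->
  marginal F S x =
  \sum_(v : 'I_(card_state i)) marginal F (i |: S) (update x v).
Proof.
move=> iS; rewrite /marginal.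
rewrite (partition_big (fun z : outcome V => z i) xpredT) //=.
apply: eq_bigr => v _; apply: eq_bigl => z.
by rewrite restr_updateU // andbC.
Qed.

Lemma marg_gt0 P S x : 0 < marg P S x.
Proof.
rewrite /marg (bigD1 x) //= ltr_pwDl ?prob_gt0 // sumr_ge0 // => z _.
exact/ltW/prob_gt0.
Qed.

Lemma marg_neq0 P S x : marg P S x != 0.
Proof. exact/lt0r_neq0/marg_gt0. Qed.

Lemma cond_gt0 P S T x : 0 < cond P S T x.
Proof. by rewrite divr_gt0 ?marg_gt0. Qed.

Lemma eq_cond P S T x y :
  restr (S :|: T) x = restr (S :|: T) y -> cond P S T x = cond P S T y.
Proof.
move=> eqxy; congr (_ / _); first exact: eq_marginal.
by apply: eq_marginal; apply: restr_sub eqxy; apply: subsetUr.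
Qed.

Lemma eq_cond1 P i T x y :
  restr T x = restr T y -> x i = y i -> cond P [set i] T x = cond P [set i] T y.
Proof.
move=> /restr_eqP eqT eqi; apply: eq_cond; apply/restr_eqP=> j.
by case/setU1P=> [-> | /eqT].
Qed.

Lemma sum_cond P i T x : i \notin T ->
  \sum_(v : 'I_(card_state i)) cond P [set i] T (update x v) = 1.
Proof.
move=> iT; under eq_bigr => v _.
  rewrite /cond [marg _ T _](eq_marginal P (restr_update x v iT)); over.
by rewrite -mulr_suml -[X in X / _](marginal_sum P x iT) divff // marg_neq0.
Qed.

(** If P(x_i | x_T) equals [c] on all extensions of a context x_S, its average P(x_i | x_S) is [c]
    too. The variables of [T :\: S] are summed out one at a time, by induction on a bound for their
    number. *)
Lemma marg_factor_sub P i c S T x0 : i \notin T -> S \subset T ->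
    (forall x, restr (i |: S) x = restr (i |: S) x0 ->
       marg P (i |: T) x = c * marg P T x) ->
  marg P (i |: S) x0 = c * marg P S x0.
Proof.
move=> iT sST cT; move: {2}_.+1 (ltnSn #|T :\: S|) => m.
elim: m => // m IHm in T iT sST cT *; rewrite ltnS => leTSm.
have [TS0 | [j /setDP[Tj Sj]]] := set_0Vmem (T :\: S).
  suffices <-: T = S by apply: cT.
  by apply/eqP; rewrite eqEsubset -finset.setD_eq0 TS0 eqxx.
have ij : j != i by apply: contraNneq iT => <-.
apply: (IHm (T :\ j)); first by rewrite !inE (negbTE iT) andbF.
- by rewrite subsetD1 sST.
- move=> x xS; have jT : j \notin T :\ j by rewrite !inE eqxx.
  have jiT : j \notin i |: (T :\ j) by rewrite !inE eqxx orbF.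
  rewrite [LHS](marginal_sum P x jiT) [marg P _ x](marginal_sum P x jT).
  rewrite mulr_sumr.
  apply: eq_bigr => v _.
  rewrite finset.setUCA (setD1K Tj); apply: cT; rewrite restr_update //.
  by rewrite !inE negb_or ij.
- apply: leq_trans leTSm.
  have -> : T :\ j :\: S = T :\: S :\ j by rewrite !setDDl finset.setUC.
  by rewrite [X in (_ < X)%N](cardsD1 j) !inE Sj Tj.
Qed.

(** The bridge from conditional independence to stages: dropping variables from the condition
    amounts to the finer conditional being constant on the context. *)
Lemma cond_subP P i S T (xS : suboutcome S) : i \notin T -> S \subset T ->
  (forall x, restr S x = xS -> cond P [set i] T x = cond P [set i] S x) <->
  (forall x y, restr S x = xS -> restr S y = xS -> x i = y i ->
     cond P [set i] T x = cond P [set i] T y).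
Proof.
move=> iT sST; split=> [eqTS x y xSx ySx xyi | eqT x xSx].
  by rewrite !eqTS //; apply: eq_cond1; rewrite // xSx.
(* The constant to be averaged is the value of the finer conditional at [x] itself. *)
apply/esym/(canLR (mulfK (marg_neq0 P S x))).
apply: marg_factor_sub iT sST _ => y eqyx.
have /restr_eqP eqyx' := eqyx.
rewrite [cond _ _ _ x](eqT x y) // ?divfK ?marg_neq0 //.
  by rewrite -xSx; apply: restr_sub eqyx; apply: subsetUr.
by rewrite eqyx' // setU11.
Qed.

End Marginals.

(** * Chain rule along an ordering, and distributions built from kernels *)

Section Orderings.
Variables (R : realType) (V : vars) (pi : {perm var V}).
Implicit Types (P : dist R V) (x y z : outcome V).

(** Unlike [before], it also covers [m = nvars V], the full vector, where the inductions on [m] have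
    to start or end. *)
Definition prefix (m : nat) : {set var V} :=
  [set pi j | j : 'I_(nvars V) & (j < m)%N].

Lemma in_prefix m j : (pi j \in prefix m) = (j < m)%N.
Proof. by rewrite mem_imset ?inE //; apply: perm_inj. Qed.

Lemma in_before k j : (pi j \in before pi k) = (j < k)%N.
Proof. exact: in_prefix. Qed.

Lemma before_irrefl k : pi k \notin before pi k.
Proof. by rewrite in_before ltnn. Qed.

Lemma prefix0 : prefix 0 = finset.set0.
Proof. by apply/setP=> i; rewrite -(permKV pi i) in_prefix inE. Qed.

Lemma prefix_full : prefix (nvars V) = [set: var V].
Proof. by apply/setP=> i; rewrite -(permKV pi i) in_prefix inE ltn_ord. Qed.

Lemma prefixS (k : 'I_(nvars V)) : prefix k.+1 = pi k |: before pi k.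
Proof.
apply/setP=> i; rewrite -(permKV pi i) in_prefix in_setU1 in_before.
by rewrite (inj_eq perm_inj) ltnS leq_eqVlt.
Qed.

Lemma before_last (k : 'I_(nvars V)) :
  k.+1 = nvars V -> before pi k = ~: [set pi k].
Proof.
move=> lastk; apply/setP=> i; rewrite -(permKV pi i) in_before !inE.
rewrite (inj_eq perm_inj) -val_eqE /= ltn_neqAle -ltnS lastk ltn_ord andbT //.
Qed.

Definition kernel P k x := cond P [set pi k] (before pi k) x.

Lemma kernel_gt0 P k x : 0 < kernel P k x.
Proof. exact: cond_gt0. Qed.

Lemma eq_kernel P k x y : restr (before pi k) x = restr (before pi k) y ->
  x (pi k) = y (pi k) -> kernel P k x = kernel P k y.
Proof. exact: eq_cond1. Qed.

Lemma sum_kernel P k x :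
  \sum_(v : 'I_(card_state (pi k))) kernel P k (update x v) = 1.
Proof. exact/sum_cond/before_irrefl. Qed.

Lemma prod_ord_recr (f : 'I_(nvars V) -> R) (k : 'I_(nvars V)) :
  \prod_(j < nvars V | (j < k.+1)%N) f j
  = f k * \prod_(j < nvars V | (j < k)%N) f j.
Proof.
rewrite (bigD1 k) //=; congr (_ * _); apply: eq_bigl => j.
by rewrite ltnS [RHS]ltn_neqAle andbC.
Qed.

Lemma chain_rule P m x : (m <= nvars V)%N ->
  marg P (prefix m) x = \prod_(k < nvars V | (k < m)%N) kernel P k x.
Proof.
elim: m => [_ | m IHm ltmV].
  by rewrite prefix0 big_pred0 // [LHS]marginal_empty prob_sum1.
have -> : m = Ordinal ltmV by [].
rewrite prod_ord_recr -IHm ?(ltnW ltmV) // prefixS.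
by rewrite /kernel /cond divfK // marg_neq0.
Qed.

Lemma prob_prod_kernel P x : P x = \prod_k kernel P k x.
Proof.
rewrite -[LHS]marginal_full -prefix_full [LHS]chain_rule //.
by apply: eq_bigl => k; rewrite ltn_ord.
Qed.

Lemma marg_before_last P (l : 'I_(nvars V)) c x : l.+1 = nvars V -> pi l = c ->
  marg P (before pi l) x = \sum_(v : 'I_(card_state c)) P (update x v).
Proof.
move=> lastl <-; rewrite [LHS](marginal_sum P x (before_irrefl l)).
by apply: eq_bigr => v _; rewrite -prefixS lastl prefix_full marginal_full.
Qed.

Lemma kernel_last P (l : 'I_(nvars V)) c x : l.+1 = nvars V -> pi l = c ->
  kernel P l x = P x / \sum_(v : 'I_(card_state c)) P (update x v).
Proof.
move=> lastl pil; rewrite -(marg_before_last P x lastl pil); congr (_ / _).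
by rewrite -prefixS lastl prefix_full [LHS]marginal_full.
Qed.

(** These families parametrize the distributions: [prob_prod_kernel] recovers a distribution from
    its kernels, and [kernel_dist] builds one with prescribed kernels. *)
Definition kernel_system (f : 'I_(nvars V) -> outcome V -> R) : Prop :=
  [/\ forall k x, 0 < f k x,
      forall k x y, restr (before pi k) x = restr (before pi k) y ->
        x (pi k) = y (pi k) -> f k x = f k y
    & forall k x, \sum_(v : 'I_(card_state (pi k))) f k (update x v) = 1].

Section KernelSystem.
Variable f : 'I_(nvars V) -> outcome V -> R.
Hypothesis fP : kernel_system f.

Let F x := \prod_k f k x.

Lemma marginal_prod m x : (m <= nvars V)%N ->
  marginal F (prefix m) x = \prod_(k < nvars V | (k < m)%N) f k x.
Proof.
have [_ f_dep f_sum] := fP.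
(* Induction from the full vector down to [m]: summing out [pi m] removes its factor, which sums to
   1, while the earlier factors ignore its value. *)
move: {2}(nvars V - m)%N (erefl (nvars V - m)%N) => d.
elim: d => [|d IHd] in m x *.
  move=> /eqP; rewrite subn_eq0 => leVm lemV.
  have -> : m = nvars V by apply/eqP; rewrite eqn_leq lemV.
  by rewrite prefix_full marginal_full; apply: eq_bigl => k; rewrite ltn_ord.
move=> eqd _; have ltmV : (m < nvars V)%N by rewrite -subn_gt0 eqd.
set k := Ordinal ltmV; have -> : m = k by [].
rewrite (marginal_sum F x (before_irrefl k)) -prefixS.
under eq_bigr => v _.
  rewrite IHd ?subnS ?eqd //.
  rewrite prod_ord_recr.
  under eq_bigr => j ltjk.
    rewrite (f_dep j (update x v) x); last 2 first.
    - by rewrite restr_update // in_before -leqNgt ltnW.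
    - by rewrite update_other // (inj_eq perm_inj) neq_ltn ltjk.
    over.
  over.
by rewrite -mulr_suml f_sum mul1r.
Qed.

Lemma prod_kernel_gt0 x : 0 < F x.
Proof. by have [f_gt0 _ _] := fP; apply: prodr_gt0. Qed.

Lemma sum_prod_kernel : \sum_x F x = 1.
Proof.
rewrite -(marginal_empty F (zero_outcome V)) -prefix0 marginal_prod //.
by rewrite big_pred0.
Qed.

Definition kernel_dist := Dist prod_kernel_gt0 sum_prod_kernel.

(** Uniqueness of the factorization: each kernel is a quotient of two consecutive partial products.
    It is stated for any [P] with this density so that it also applies to a given member of a DAG
    model. *)
Lemma prod_kernelE P k x : (forall y, P y = F y) -> kernel P k x = f k x.
Proof.
move=> eqPF; have margE S y : marg P S y = marginal F S y.
  exact: eq_bigr.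
have [f_gt0 _ _] := fP.
rewrite /kernel /cond !margE -prefixS !marginal_prod ?ltn_ord // 1?ltnW //.
rewrite prod_ord_recr mulfK // lt0r_neq0 //; exact: prodr_gt0.
Qed.

Lemma kernel_distE k x : kernel kernel_dist k x = f k x.
Proof. exact: prod_kernelE. Qed.

End KernelSystem.
End Orderings.

(** * DAG and LDAG models as equalities between kernels *)

Section Models.
Variables (R : realType) (V : vars).
Implicit Types (P : dist R V) (x y z : outcome V) (pi : {perm var V}).

Definition topological (G : dag V) pi :=
  forall j k, edge G (pi j) (pi k) -> (j < k)%N.

Lemma pa_before G pi k : topological G pi -> pa G (pi k) \subset before pi k.
Proof.
move=> topG; apply/subsetP=> i; rewrite -(permKV pi i) in_before inE.
exact: topG.
Qed.

Lemma edge_irrefl (G : dag V) i : ~~ edge G i i.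
Proof.
apply/negP=> Gii; have := @dag_acyclic _ G [:: i].
by rewrite /= Gii => /(_ isT).
Qed.

Lemma notin_pa (G : dag V) i : i \notin pa G i.
Proof. by rewrite inE edge_irrefl. Qed.

Lemma topological_order (G : dag V) : exists pi, topological G pi.
Proof.
(* Sort the variables by their number of ancestors. *)
pose anc i := #|[set j | connect (edge G) j i]|.
have anc_lt i j : edge G i j -> (anc i < anc j)%N.
  move=> Gij; apply: proper_card; apply/properP; split.
    apply/subsetP=> l; rewrite !inE => li; apply: connect_trans li _.
    exact: connect1.
  exists j; rewrite !inE ?connect0 //; apply/negP=> /connectP[p Gp lastp].
  have := @dag_acyclic _ G (j :: p); rewrite /= rcons_path Gp -lastp Gij.
  by move/(_ isT).
pose le_anc i j := (anc i <= anc j)%N.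
have le_anc_total : total le_anc by move=> i j; apply: leq_total.
have le_anc_trans : transitive le_anc by move=> i j l; apply: leq_trans.
pose s := sort le_anc (enum (var V)).
have size_s : size s = nvars V by rewrite size_sort size_enum_ord.
have s_uniq : uniq s by rewrite sort_uniq enum_uniq.
have nth_inj : injective (fun k : 'I_(nvars V) => nth k s k).
  move=> j k; rewrite (set_nth_default k) ?size_s // => /eqP.
  by rewrite nth_uniq ?size_s // => /eqP/val_inj.
exists (perm nth_inj) => j k; rewrite !permE => /anc_lt; apply: contraTT.
rewrite -!leqNgt => lekj; rewrite [nth j s j](set_nth_default k) ?size_s //.
have := sort_sorted le_anc_total (enum (var V)).
move/(sorted_leq_nth le_anc_trans (fun=> leqnn _)).
by apply; rewrite ?inE ?size_s.
Qed.

(** The conditionals given the parents form a kernel system along a topological ordering, so the DAG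
    factorization forces them to be the kernels of [P]. The converse is the chain rule. *)
Lemma dag_kernelP G pi P : topological G pi ->
  dag_model G P <->
  (forall k x, kernel pi P k x = cond P [set pi k] (pa G (pi k)) x).
Proof.
move=> topG; have sub_pa k := pa_before k topG.
have prod_pi (f : var V -> R) : \prod_i f i = \prod_k f (pi k).
  by rewrite (reindex_inj (@perm_inj _ pi)).
split=> [GP k x | eqK x].
  apply: (prod_kernelE (f := fun k => cond P [set pi k] (pa G (pi k)))).
    split=> [j y | j y z eqyz eqj | j y]; first exact: cond_gt0.
      by apply: eq_cond1 => //; apply: restr_sub eqyz.
    by apply: sum_cond; apply: notin_pa.
  by move=> y; rewrite [LHS]GP; apply: prod_pi.
rewrite (prob_prod_kernel pi) [RHS]prod_pi.
by apply: eq_bigr => k _; rewrite eqK.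
Qed.

Lemma dag_modelP G pi P : topological G pi ->
  dag_model G P <->
  (forall k x y, restr (pa G (pi k)) x = restr (pa G (pi k)) y ->
     x (pi k) = y (pi k) -> kernel pi P k x = kernel pi P k y).
Proof.
move=> topG; rewrite (dag_kernelP _ topG).
split=> [eqK k x y eqxy eqk | eqK k x]; first by rewrite !eqK; apply: eq_cond1.
apply: (cond_subP P _ (before_irrefl pi k) (pa_before k topG)).2 (erefl _).
by move=> y z yx zx; apply: eqK; rewrite yx zx.
Qed.

(** Within the DAG model a kernel is the conditional given the parents, and [cond_subP] turns
    independence in a labeled context into constancy of that conditional. *)
Lemma ldag_modelP (G : ldag V) pi P : topological G pi ->
  ldag_model G P <-> dag_model G P /\
  (forall k j (e : edge G j (pi k)) x y,
     restr (pa G (pi k) :\ j) x \in label e ->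
     restr (pa G (pi k) :\ j) x = restr (pa G (pi k) :\ j) y ->
     x (pi k) = y (pi k) -> kernel pi P k x = kernel pi P k y).
Proof.
move=> topG; split=> -[GP lab]; split=> //.
  move=> k j e x y labx eqxy eqk.
  rewrite !(dag_kernelP P topG).1 //.
  apply: (cond_subP P (restr _ x) (notin_pa _ _) (subD1set _ j)).1 => // z eqz.
  have := lab _ _ e _ labx z eqz.
  by rewrite !setU0 !set0U setD1K // inE.
move=> j i; rewrite -(permKV pi i); set k := (pi^-1)%g i => e xS labxS x eqx.
rewrite !setU0 !set0U setD1K ?inE //.
apply: (cond_subP P xS (notin_pa _ _) (subD1set _ j)).2 => //.
move=> y z eqy eqz eqk; rewrite -!(dag_kernelP P topG).1 //.
by apply: (lab k j e) eqk; rewrite eqy ?eqz.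
Qed.

End Models.

(** * Staged trees and CStrees as equalities between kernels *)

Section Trees.
Variables (R : realType) (V : vars).
Implicit Types (P : dist R V) (x y z : outcome V) (pi : {perm var V}).

Definition same_stage (T : stagedTree V) k
    (s t : suboutcome (before (st_order T) k)) :=
  exists2 B, B \in stages T k & (s \in B) && (t \in B).

Lemma stagedTree_modelP (T : stagedTree V) P :
  stagedTree_model T P <->
  (forall k x y, same_stage (T := T) (k := k) (restr _ x) (restr _ y) ->
     x (st_order T k) = y (st_order T k) ->
     kernel (st_order T) P k x = kernel (st_order T) P k y).
Proof.
split=> [TP k x y [B TB /andP[xB yB]] | TP k B TB x y xB yB].
  exact: TP TB _ _ xB yB.
by apply: TP; exists B; rewrite // xB.
Qed.

Lemma same_stage_pblock (T : stagedTree V) k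
    (s t : suboutcome (before (st_order T) k)) :
  same_stage s t <-> pblock (stages T k) s = pblock (stages T k) t.
Proof.
have /and3P[/eqP covT trivT _] := stages_partition T k.
have inT r : r \in cover (stages T k) by rewrite covT inE.
split=> [[B TB /andP[sB tB]] | eqst]; first by rewrite !(def_pblock trivT TB).
exists (pblock (stages T k) s); first exact: pblock_mem.
by rewrite {2}eqst !mem_pblock !inT.
Qed.

Lemma in_stage pi k (S : {set var V}) (xS : suboutcome S) x :
    S \subset before pi k ->
  (restr (before pi k) x \in stage pi k xS) = (restr S x == xS).
Proof. by move=> sSk; rewrite inE -(extendK xS) agree_restr. Qed.

(** By [cond_subP], the independence attached to a cylinder says that the kernel is constant on
    it. *)
Lemma csTree_modelP (T : csTree V) P :
  csTree_model T P <-> stagedTree_model T P.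
Proof.
have CSI_T k S (xS : suboutcome S) (sSk : S \subset before (st_order T) k) :=
  cond_subP P xS (before_irrefl (st_order T) k) sSk.
have eqS k (S : {set var V}) : S \subset before (st_order T) k ->
    before (st_order T) k :\: S :|: finset.set0 :|: S = before (st_order T) k.
  move=> /subsetP sSk; apply/setP=> i; rewrite !inE orbF.
  by case: (boolP (i \in S)) => [/sSk -> | _]; rewrite ?orbF.
split=> [TP k B TB x y xB yB | TP k S xS sSk TS].
  have [S [xS [sSk defB]]] := cst_stages TB.
  rewrite {B}defB !in_stage // in TB xB yB.
  have := TP k S xS sSk TB; rewrite /CSI eqS // set0U => /CSI_T; apply=> //.
    exact/eqP.
  exact/eqP.
rewrite /CSI eqS // set0U; apply/CSI_T => // x y /eqP xS_x /eqP xS_y.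
by apply: TP TS _ _ _ _; rewrite in_stage.
Qed.

Section RelationTree.
Variables (pi : {perm var V}) (e : forall k, rel (suboutcome (before pi k))).
Hypothesis eP : forall k, equivalence_rel (@e k).

Lemma relation_stages_partition k :
  partition (equivalence_partition (@e k) [set: _])
    [set: suboutcome (before pi k)].
Proof. by apply: equivalence_partitionP => r s t _ _ _; apply: eP. Qed.

Definition relation_tree := StagedTree relation_stages_partition.

Lemma same_stage_relation k s t :
  same_stage (T := relation_tree) (k := k) s t <-> e s t.
Proof.
split=> [[B /imsetP[r _ ->]] | est].
  by rewrite !inE /= => /andP[ers ert]; have [_ /(_ ers) <-] := eP r s t.
exists [set r in [set: _] | e s r]; first exact: imset_f.
by rewrite !inE est (eP s s s).1.
Qed.

End RelationTree.

Section ContextTree.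
Variables (pi : {perm var V}) (ctx : 'I_(nvars V) -> outcome V -> {set var V}).
Hypothesis ctx_before : forall k x, ctx k x \subset before pi k.
Hypothesis ctx_stable : forall k x y,
  restr (ctx k x) y = restr (ctx k x) x -> ctx k y = ctx k x.

(** A CStree is described by the set [ctx k x] of variables that matter to [pi k] after the history
    of [x]. By [ctx_stable], agreement on this set is an equivalence relation, and its classes are
    cylinders. *)
Definition ctx_rel k : rel (suboutcome (before pi k)) := fun s t =>
  restr (ctx k (extend s)) (extend t) == restr (ctx k (extend s)) (extend s).

Lemma ctx_relP k : equivalence_rel (ctx_rel (k := k)).
Proof.
move=> r s t; split; first exact: eqxx.
by rewrite /ctx_rel => /eqP Hs; rewrite (ctx_stable Hs) Hs.
Qed.

Lemma ctx_extend k x : ctx k (extend (restr (before pi k) x)) = ctx k x.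
Proof.
apply: ctx_stable; apply/restr_eqP=> i /(subsetP (ctx_before k x)).
exact: extend_restr.
Qed.

Lemma ctx_rel_restr k x y :
  ctx_rel (k := k) (restr _ x) (restr _ y)
  = (restr (ctx k x) y == restr (ctx k x) x).
Proof.
have H z : restr (ctx k x) (extend (restr (before pi k) z)) = restr (ctx k x) z.
  by apply: restr_sub (ctx_before k x) _; rewrite extendK.
by rewrite /ctx_rel ctx_extend !H.
Qed.

Lemma context_tree_stages k B : B \in stages (relation_tree ctx_relP) k ->
  exists (S : {set var V}) (xS : suboutcome S),
    S \subset before pi k /\ B = stage pi k xS.
Proof.
case/imsetP=> s _ ->; move: s; apply: restrP => x.
exists (ctx k x), (restr (ctx k x) x); split=> //.
apply/setP; apply: restrP => y.
by rewrite !inE /= ctx_rel_restr agree_restr.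
Qed.

Definition context_tree : csTree V := CSTree context_tree_stages.

Lemma context_tree_modelP P :
  csTree_model context_tree P <->
  (forall k x y, restr (ctx k x) y = restr (ctx k x) x ->
     x (pi k) = y (pi k) -> kernel pi P k x = kernel pi P k y).
Proof.
rewrite csTree_modelP stagedTree_modelP.
split=> TP k x y.
  by move=> /eqP; rewrite -ctx_rel_restr => /same_stage_relation/TP.
by move=> /same_stage_relation; rewrite ctx_rel_restr => /eqP/TP.
Qed.

End ContextTree.
End Trees.

(** * The three inclusions *)

Section Inclusions.
Variables (R : realType) (V : vars).
Implicit Types (P : dist R V) (x y z : outcome V) (pi : {perm var V}).

(** Every history of a variable gets the same context, the full parent set. *)
Lemma dag_csTree (G : dag V) :
  exists T : csTree V,
    dag_model G = csTree_model T :> classical_sets.set (dist R V).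
Proof.
have [pi topG] := topological_order G.
have pa_sub k x := pa_before k topG.
have pa_stable k x y : restr (pa G (pi k)) y = restr (pa G (pi k)) x ->
  pa G (pi k) = pa G (pi k) by [].
exists (context_tree pa_sub pa_stable); apply/funext=> P; apply/propext.
rewrite (dag_modelP P topG) context_tree_modelP.
by split=> GP k x y eqxy; apply: GP.
Qed.

Section CompleteDag.
Variable pi : {perm var V}.

Definition precedes : rel (var V) := fun i j => ((pi^-1)%g i < (pi^-1)%g j)%N.

Lemma precedes_acyclic c : cycle precedes c -> c = [::].
Proof.
have trans : transitive precedes by move=> j i k; apply: ltn_trans.
case: c => // i c /= /(order_path_min trans)/allP/(_ i).
by rewrite mem_rcons mem_head /precedes ltnn => /(_ isT).
Qed.

(** Its factorization is the chain rule, so an LDAG over it is constrained by its labels alone. *)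
Definition complete_dag := Dag precedes_acyclic.

Lemma complete_dag_topological : topological complete_dag pi.
Proof. by move=> j k /=; rewrite /precedes !permK. Qed.

Lemma pa_complete_dag k : pa complete_dag (pi k) = before pi k.
Proof.
apply/setP=> i; rewrite -(permKV pi i) in_before inE /=.
by rewrite /precedes !permK.
Qed.

Lemma complete_dag_model P : dag_model complete_dag P.
Proof.
apply/(dag_modelP P complete_dag_topological)=> k x y.
by rewrite pa_complete_dag; apply: eq_kernel.
Qed.

End CompleteDag.

(* Labeling all contexts whose extensions lie in one stage suffices because a
   cylinder is connected by changing one variable at a time within it. *)
Definition csTree_label (T : csTree V) (j i : var V)
    (_ : edge (complete_dag (st_order T)) j i) :
    {set suboutcome (pa (complete_dag (st_order T)) i :\ j)} :=
  [set s | `[< exists k B, [/\ st_order T k = i, B \in stages T k &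
     forall x, restr (pa (complete_dag (st_order T)) i :\ j) x = s ->
       restr (before (st_order T) k) x \in B] >]].

Lemma csTree_ldag (T : csTree V) :
  exists G : ldag V,
    csTree_model T = ldag_model G :> classical_sets.set (dist R V).
Proof.
pose pi := st_order T; have topG := @complete_dag_topological pi.
exists (LDag (@csTree_label T)); apply/funext=> P; apply/propext.
rewrite csTree_modelP stagedTree_modelP (@ldag_modelP _ _ _ pi) //.
split=> [TP | [_ GP] k].
  split; first exact: complete_dag_model.
  move=> k j e x y; rewrite inE => /asboolP[k' [B [/perm_inj eqk TB xyB]]] eqxy.
  by apply: TP; subst k'; exists B; rewrite ?xyB.
move=> x y [B TB]; have [S [xS [sSk defB]]] := cst_stages TB.
rewrite {B}defB !in_stage // in TB *.
(* Induction on the number of earlier variables at which [x] and [y] differ. *)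
move: {2}_.+1 (ltnSn #|[set j in before pi k | x j != y j]|) => m.
elim: m => // m IHm in x *; rewrite ltnS => ltDm xySB eqk.
have [D0 | [j]] := set_0Vmem [set j in before pi k | x j != y j].
  apply: eq_kernel eqk; apply/restr_eqP=> i ki; apply/eqP; apply: contraT => ne.
  by have := in_set0 i; rewrite -D0 inE ki ne.
rewrite inE => /andP[kj ne_j]; have /andP[/eqP xS_x /eqP xS_y] := xySB.
have Sj : j \notin S.
  apply: contra ne_j => Sj; apply/eqP.
  by have /restr_eqP->: restr S x = restr S y by rewrite xS_x.
have jk : pi k != j by apply: contraTneq kj => <-; apply: before_irrefl.
have e : edge (complete_dag pi) j (pi k).
  by move: kj; rewrite -pa_complete_dag inE.
(* Giving coordinate [j] its value in [y] stays inside the cylinder because [j] is not in [S], and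
   the label of the edge from [j] to [pi k] permits this move. *)
rewrite (GP k j e x (update x (y j))) ?update_other //.
- apply: IHm; last by rewrite update_other.
    apply: leq_trans ltDm; apply: proper_card; apply/properP; split.
      apply/subsetP=> i; rewrite !inE => /andP[-> /=].
      have [->|ij] := eqVneq i j; first by rewrite update_same eqxx.
      by rewrite update_other.
    by exists j; rewrite !inE kj //= update_same eqxx.
  by rewrite restr_update // xS_x xS_y eqxx.
- rewrite inE; apply/asboolP; exists k, (stage pi k xS); split=> // z.
  rewrite pa_complete_dag in_stage // => eqzx; apply/eqP; rewrite -xS_x.
  by apply: restr_sub eqzx; rewrite subsetD1 sSk.
- by rewrite restr_update // !inE eqxx.
Qed.

(* Defining the stages semantically, by all distributions of the model, avoids
   generating an equivalence relation from the labels. *)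
Definition ldag_stage_rel (G : ldag V) pi k : rel (suboutcome (before pi k)) :=
  fun s t => `[< forall P, ldag_model G P -> forall v : 'I_(card_state (pi k)),
    kernel pi P k (update (extend s) v)
    = kernel pi P k (update (extend t) v) >].

Lemma ldag_stage_relP G pi k : equivalence_rel (@ldag_stage_rel G pi k).
Proof.
move=> r s t; split; first exact/asboolP.
move=> /asboolP rs; apply: asbool_equiv_eq.
by split=> H P GP v; [rewrite -rs | rewrite rs] => //; apply: H.
Qed.

(** Frees the relation from the chosen extensions, since a kernel sees only the history and the
    variable's own value. *)
Lemma ldag_stage_rel_restr G pi k x y :
  @ldag_stage_rel G pi k (restr _ x) (restr _ y) <->
  (forall P, ldag_model G P ->
     forall x' y', restr (before pi k) x' = restr (before pi k) x ->
       restr (before pi k) y' = restr (before pi k) y ->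
     x' (pi k) = y' (pi k) ->
     kernel pi P k x' = kernel pi P k y').
Proof.
have upd_restr z (v : 'I_(card_state (pi k))) :
    restr (before pi k) (update (extend (restr (before pi k) z)) v)
    = restr (before pi k) z.
  by rewrite restr_update ?extendK ?before_irrefl.
split=> [/asboolP H P GP x' y' eqx eqy eqk | H]; last first.
  by apply/asboolP=> P GP v; apply: H; rewrite ?update_same ?upd_restr.
pose x1 := update (extend (restr (before pi k) x)) (x' (pi k)).
transitivity (kernel pi P k x1).
  by apply: eq_kernel; rewrite ?update_same ?upd_restr.
by rewrite /x1 H //; apply: eq_kernel; rewrite ?update_same ?upd_restr.
Qed.

(** Members of the LDAG model respect the stages by construction. Conversely, the graph and the
    labels impose their equalities on every member, so the histories they identify share a stage. *)
Lemma ldag_stagedTree (G : ldag V) :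
  exists T : stagedTree V,
    ldag_model G = stagedTree_model T :> classical_sets.set (dist R V).
Proof.
have [pi topG] := topological_order G.
exists (relation_tree (@ldag_stage_relP G pi)); apply/funext=> P; apply/propext.
rewrite stagedTree_modelP; split=> [GP k x y /same_stage_relation | TP].
  by move/ldag_stage_rel_restr => H; apply: H.
have sub_pa k := pa_before k topG.
apply/(ldag_modelP P topG); split.
  apply/(dag_modelP P topG) => k x y eqxy; apply: TP.
  apply/same_stage_relation/ldag_stage_rel_restr => Q [GQ _] x' y' eqx eqy.
  apply: (dag_modelP Q topG).1 => //.
  by rewrite (restr_sub (sub_pa k) eqx) (restr_sub (sub_pa k) eqy).
move=> k j e x y labx eqxy; apply: TP.
apply/same_stage_relation/ldag_stage_rel_restr => Q.
move=> /(ldag_modelP Q topG)[_ GQ] x' y' eqx eqy.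
have sub_paD : pa G (pi k) :\ j \subset before pi k.
  exact: fintype.subset_trans (subD1set _ _) (sub_pa k).
apply: (GQ k j e); first by rewrite (restr_sub sub_paD eqx).
by rewrite (restr_sub sub_paD eqx) (restr_sub sub_paD eqy).
Qed.

End Inclusions.

(** * Invariance under permuting the states of each variable *)

Section Relabeling.
Variables (R : realType) (V : vars).
Variable s : forall i : var V, {perm 'I_(card_state i)}.
Implicit Types (P : dist R V) (x y z : outcome V).

Definition relabel x : outcome V := [ffun i => s i (x i)].

Lemma relabel_inj : injective relabel.
Proof.
move=> x y /ffunP eqxy; apply/ffunP=> i.
by have := eqxy i; rewrite !ffunE => /perm_inj.
Qed.

Lemma restr_relabel S x y :
  (restr S (relabel x) == restr S (relabel y)) = (restr S x == restr S y).
Proof.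
apply/eqP/eqP=> /restr_eqP eqxy; apply/restr_eqP=> i Si.
  by have := eqxy i Si; rewrite !ffunE => /perm_inj.
by rewrite !ffunE eqxy.
Qed.

Lemma relabel_prob_gt0 P x : 0 < P (relabel x).
Proof. exact: prob_gt0. Qed.

Lemma relabel_prob_sum1 P : \sum_x P (relabel x) = 1.
Proof. by rewrite -(prob_sum1 P) [RHS](reindex_inj relabel_inj). Qed.

Definition relabel_dist P := Dist (relabel_prob_gt0 P) (relabel_prob_sum1 P).

Lemma marg_relabel P S x : marg (relabel_dist P) S x = marg P S (relabel x).
Proof.
rewrite /marg [RHS](reindex_inj relabel_inj).
by apply: eq_bigl => z; rewrite restr_relabel.
Qed.

Lemma cond_relabel P S T x :
  cond (relabel_dist P) S T x = cond P S T (relabel x).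
Proof. by rewrite /cond !marg_relabel. Qed.

Lemma kernel_relabel pi P k x :
  kernel pi (relabel_dist P) k x = kernel pi P k (relabel x).
Proof. exact: cond_relabel. Qed.

Lemma dag_model_relabel G P : dag_model G P -> dag_model G (relabel_dist P).
Proof.
move=> GP x; rewrite [LHS]GP; apply: eq_bigr => i _.
by rewrite cond_relabel.
Qed.

(* With two variables the labels are contexts of no variable at all. *)
Lemma ldag_model_relabel (G : ldag V) P : (nvars V <= 2)%N ->
  ldag_model G P -> ldag_model G (relabel_dist P).
Proof.
move=> leV2 [GP lab]; split; first exact: dag_model_relabel.
move=> j i e xS labxS x xSx.
have ji : j != i by apply/eqP=> ji; have := edge_irrefl G i; rewrite -{1}ji e.
rewrite !cond_relabel; apply: (lab j i e xS labxS).
apply/ffunP=> -[k paj_k]; have /setD1P[kj pa_k] := paj_k.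
have ki : k != i by apply: contraTneq pa_k => ->; apply: notin_pa.
suffices : (2 < #|var V|)%N by rewrite card_ord ltnNge leV2.
apply: leq_trans (max_card (mem [set i; j; k])).
by rewrite -setUA cardsU1 cards2 !inE negb_or eq_sym ji eq_sym ki eq_sym kj.
Qed.

End Relabeling.

(** * Distributions in which a single variable responds to its history *)

Section LastVariable.
Variables (R : realType) (V : vars) (pi : {perm var V}) (l : 'I_(nvars V)).
Variable h : outcome V -> R.
Implicit Types x y : outcome V.
Hypothesis h_gt0 : forall x, 0 < h x.
Hypothesis h_lt1 : forall x, h x < 1.
Hypothesis h_before : forall x y,
  restr (before pi l) x = restr (before pi l) y -> h x = h y.

(** Only [pi l] reacts to its history, so the resulting distribution lies in a staged tree model
    with ordering [pi] as soon as [h] is constant on the stages of [l]. *)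
Definition response_kernel k (x : outcome V) : R :=
  if k == l then
    if x (pi l) == 0%N :> nat then h x
    else (1 - h x) / (card_state (pi l)).-1%:R
  else (card_state (pi k))%:R^-1.

Lemma response_kernelP : kernel_system pi response_kernel.
Proof.
have card_neq0 i : (card_state i)%:R != 0 :> R.
  by rewrite pnatr_eq0 -lt0n card_state_gt0.
have pred_gt0 i : (0 < (card_state (i : var V)).-1)%N.
  by rewrite -ltnS prednK ?card_state_gt0 ?card_state_gt1.
split=> [k x | k x y eqxy eqk | k x]; rewrite /response_kernel.
- case: eqP => _; last by rewrite invr_gt0 ltr0n card_state_gt0.
  by case: ifP => _ //; rewrite divr_gt0 ?subr_gt0 // ltr0n.
- by case: eqP => // eqkl; subst l; rewrite eqk (h_before eqxy).
case: eqP => [eqkl | _]; last first.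
  by rewrite sumr_const card_ord -[LHS]mulr_natl divff.
subst l; rewrite (bigD1 (Ordinal (card_state_gt0 (pi k)))) //=.
rewrite update_same eqxx.
rewrite (eq_bigr (fun=> (1 - h x) / (card_state (pi k)).-1%:R)).
  rewrite sumr_const (_ : #|_| = (card_state (pi k)).-1).
    rewrite -[X in _ + X = _]mulr_natr divfK ?pnatr_eq0 -?lt0n //.
    rewrite (h_before (restr_update x _ (before_irrefl pi k))); ring.
  by rewrite cardC1 card_ord.
move=> v; rewrite -val_eqE /= => /negbTE v0; rewrite update_same v0.
by rewrite (h_before (restr_update x _ (before_irrefl pi k))).
Qed.

Definition response_dist : dist R V := kernel_dist response_kernelP.

Lemma kernel_response_last x : x (pi l) = 0%N :> nat ->
  kernel pi response_dist l x = h x.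
Proof. by move=> xl; rewrite kernel_distE /response_kernel eqxx xl. Qed.

Lemma eq_kernel_response k x y : x (pi k) = y (pi k) -> (k = l -> h x = h y) ->
  kernel pi response_dist k x = kernel pi response_dist k y.
Proof.
move=> eqk eqh; rewrite !kernel_distE /response_kernel.
by case: eqP => // eqkl; subst k; rewrite eqk eqh.
Qed.

End LastVariable.

(** * Strictness: a staged tree on two ternary variables that is no LDAG *)

Section Separations.
Variable R : realType.

Definition two_ternary := @Vars 2 (fun=> 3) (fun=> isT).
Definition u0 : var two_ternary := ord0.
Definition u1 : var two_ternary := ord_max.

Definition state2_prob (x : outcome two_ternary) : R :=
  if x u0 == 2%N :> nat then 2 / 3 else 1 / 3.

Lemma state2_prob_gt0 x : 0 < state2_prob x.
Proof. by rewrite /state2_prob; case: ifP => _; lra. Qed.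

Lemma state2_prob_lt1 x : state2_prob x < 1.
Proof. by rewrite /state2_prob; case: ifP => _; lra. Qed.

Lemma u0_before_u1 : u0 \in before 1%g u1.
Proof. by rewrite -[u0]perm1 in_before. Qed.

Lemma state2_prob_before x y :
  restr (before 1%g u1) x = restr (before 1%g u1) y ->
  state2_prob x = state2_prob y.
Proof.
by move/restr_eqP/(_ u0 u0_before_u1) => eq0; rewrite /state2_prob eq0.
Qed.

(** The stages of X_1 are X_0 = 2 and X_0 in {0, 1}. The empty history of X_0 forms a single
    stage. *)
Definition state2_rel k : rel (suboutcome (before (V := two_ternary) 1%g k)) :=
  fun s t => (extend s u0 == 2%N :> nat) == (extend t u0 == 2%N :> nat).

Lemma state2_relP k : equivalence_rel (@state2_rel k).
Proof. by move=> r s t; split; rewrite /state2_rel // => /eqP->. Qed.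

(** Swapping states 1 and 2 of X_0 keeps [P] in any LDAG model on these variables, but then the
    histories 0 and 1, which share a stage, give X_1 = 0 the probabilities 1/3 and 2/3. *)
Lemma stagedTree_not_ldag : exists T : stagedTree two_ternary,
  forall G : ldag two_ternary,
    stagedTree_model T <> ldag_model G :> classical_sets.set (dist R _).
Proof.
pose T := relation_tree state2_relP; exists T => G eqTG.
pose P := response_dist state2_prob_gt0 state2_prob_lt1 state2_prob_before.
pose s i : {perm 'I_(@card_state two_ternary i)} :=
  if i == u0 then tperm (@Ordinal 3 1 isT) (@Ordinal 3 2 isT) else 1%g.
have TP : stagedTree_model T P.
  apply/stagedTree_modelP => k x y /same_stage_relation exy eqk.
  apply: eq_kernel_response eqk _ => eqk; subst k.
  move: exy; rewrite /state2_rel /state2_prob.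
  by rewrite !extend_restr ?u0_before_u1 // => /eqP->.
have GsP : ldag_model G (relabel_dist s P).
  by apply: ldag_model_relabel; rewrite -?eqTG.
rewrite -eqTG in GsP.
pose z := zero_outcome two_ternary.
pose z1 := @update _ z u0 (@Ordinal 3 1 isT).
have/stagedTree_modelP/(_ u1 z z1) := GsP.
have zz1 : same_stage (T := T) (k := u1) (restr _ z) (restr _ z1).
  apply/same_stage_relation; rewrite /state2_rel !extend_restr ?u0_before_u1 //.
  by rewrite zero_outcome_val update_val.
have sz : relabel s z u0 = 0%N :> nat.
  by rewrite ffunE ffunE /s /= tpermD.
have sz1 : relabel s z1 u0 = 2%N :> nat.
  by rewrite ffunE update_same /s /= tpermL.
have su1 x : relabel s x u1 = x u1 by rewrite ffunE /s /= perm1.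
have z1u1 : z1 u1 = z u1 by rewrite update_other.
move=> /(_ zz1); rewrite !kernel_relabel !kernel_response_last perm1 ?su1 ?z1u1;
  [| exact: zero_outcome_val | exact: zero_outcome_val].
rewrite /state2_prob sz sz1 /= => /(_ erefl); lra.
Qed.

(** * A CStree on three binary variables that is no DAG *)

Definition three_binary := @Vars 3 (fun=> 2) (fun=> isT).
Definition v0 : var three_binary := ord0.
Definition v1 : var three_binary := @Ordinal 3 1 isT.
Definition v2 : var three_binary := ord_max.

(** A noisy conjunction used as the probability of X_2 = 0. It serves two separations, being
    constant both on X_0 = 0 and on the histories 00, 01, 10, but not on X_0 = 1. *)
Definition conj_prob (x : outcome three_binary) : R :=
  if (x v0 == 1%N :> nat) && (x v1 == 1%N :> nat) then 2 / 3 else 1 / 3.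

Lemma conj_prob_gt0 x : 0 < conj_prob x.
Proof. by rewrite /conj_prob; case: ifP => _; lra. Qed.

Lemma conj_prob_lt1 x : conj_prob x < 1.
Proof. by rewrite /conj_prob; case: ifP => _; lra. Qed.

Lemma v0_before : v0 \in before 1%g v2.
Proof. by rewrite -[v0]perm1 in_before. Qed.

Lemma v1_before : v1 \in before 1%g v2.
Proof. by rewrite -[v1]perm1 in_before. Qed.

Lemma conj_prob_before x y :
  restr (before 1%g v2) x = restr (before 1%g v2) y ->
  conj_prob x = conj_prob y.
Proof.
move/restr_eqP=> eqxy.
by rewrite /conj_prob (eqxy _ v0_before) (eqxy _ v1_before).
Qed.

Definition conj_dist :=
  response_dist conj_prob_gt0 conj_prob_lt1 conj_prob_before.

(* X_2 is independent of X_1 in the context X_0 = 0 only. *)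
Definition half_ctx k (x : outcome three_binary) : {set var three_binary} :=
  before 1%g k :&: (if x v0 == 0%N :> nat then [set v0] else [set: _]).

Lemma half_ctx_before k x : half_ctx k x \subset before 1%g k.
Proof. exact: subsetIl. Qed.

(** The context contains [v0] whenever [v0] precedes [k], so agreement on it decides the case
    distinction; otherwise [k] is first and the context is empty. *)
Lemma half_ctx_stable k x y :
  restr (half_ctx k x) y = restr (half_ctx k x) x ->
  half_ctx k y = half_ctx k x.
Proof.
move=> /restr_eqP eqxy; have [k0 | k0] := boolP (v0 \in before 1%g k).
  by rewrite /half_ctx eqxy // !inE k0; case: ifP; rewrite inE.
have k_eq0 : before 1%g k = finset.set0.
  move: k0; rewrite -[v0]perm1 in_before -leqNgt leqn0 => /eqP k0.
  by apply/setP=> i; rewrite -[i]perm1 in_before k0 inE.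
by rewrite /half_ctx k_eq0 !set0I.
Qed.

(** Exchanging the states of X_0 would keep [conj_dist] in a DAG model, but it moves the dependence
    of X_2 on X_1 into the context X_0 = 0. *)
Lemma csTree_not_dag : exists T : csTree three_binary,
  forall G : dag three_binary,
    csTree_model T <> dag_model G :> classical_sets.set (dist R _).
Proof.
pose T := context_tree half_ctx_before half_ctx_stable; exists T => G eqTG.
pose s i : {perm 'I_(@card_state three_binary i)} :=
  if i == v0 then tperm (@Ordinal 2 0 isT) (@Ordinal 2 1 isT) else 1%g.
have TP : csTree_model T conj_dist.
  apply/context_tree_modelP => k x y /restr_eqP exy eqk.
  apply: eq_kernel_response eqk _ => eqk; subst k; rewrite /half_ctx in exy.
  have eq0 : y v0 = x v0.
    by rewrite exy // inE v0_before; case: ifP; rewrite inE.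
  rewrite /conj_prob eq0; case: eqP => //= x0.
  by rewrite exy // inE v1_before x0 inE.
have GsP : dag_model G (relabel_dist s conj_dist).
  by apply: dag_model_relabel; rewrite -eqTG.
rewrite -eqTG in GsP.
pose z := zero_outcome three_binary.
pose z1 := @update _ z v1 (@Ordinal 2 1 isT).
have/context_tree_modelP/(_ v2 z z1) := GsP.
have -> : restr (half_ctx v2 z) z1 = restr (half_ctx v2 z) z.
  by rewrite restr_update // /half_ctx zero_outcome_val !inE andbF.
have sz0 : relabel s z v0 = 1%N :> nat.
  rewrite ffunE /s /= (_ : z v0 = @Ordinal 2 0 isT) ?tpermL //.
  exact/val_inj/zero_outcome_val.
have sz10 : relabel s z1 v0 = 1%N :> nat.
  by rewrite -[RHS]sz0 [in LHS]ffunE update_other // [in RHS]ffunE.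
have s1 x : relabel s x v1 = x v1 by rewrite ffunE /s /= perm1.
have s2 x : relabel s x v2 = x v2 by rewrite ffunE /s /= perm1.
have z12 : z1 v2 = z v2 by rewrite update_other.
rewrite !kernel_relabel !kernel_response_last perm1 ?s2 ?z12;
  [| exact: zero_outcome_val | exact: zero_outcome_val].
rewrite /conj_prob sz0 sz10 !s1 update_val zero_outcome_val /=.
by move=> /(_ erefl erefl); lra.
Qed.

(* P(x_2 | x_0, x_1) does not depend on (x_0, x_1) unless x_0 = x_1 = 1; the
   context of 0 -> 1 is empty, so X_0 and X_1 are also independent. *)
Definition zero_label (j i : var three_binary)
    (_ : edge (complete_dag (V := three_binary) 1%g) j i) :
    {set suboutcome (pa (complete_dag (V := three_binary) 1%g) i :\ j)} :=
  [set restr _ (zero_outcome three_binary)].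

Definition zero_ldag := LDag zero_label.

Lemma zero_ldag_modelP (P : dist R three_binary) : ldag_model zero_ldag P <->
  (forall k j x y, j \in before 1%g k ->
     restr (before 1%g k :\ j) x
     = restr (before 1%g k :\ j) (zero_outcome three_binary) ->
     restr (before 1%g k :\ j) x = restr (before 1%g k :\ j) y ->
     x k = y k -> kernel 1%g P k x = kernel 1%g P k y).
Proof.
rewrite (@ldag_modelP _ _ _ 1%g) //; last first.
  exact: (@complete_dag_topological _ 1%g).
split=> [[_ H] k j x y kj | H].
  have e : edge zero_ldag j ((1%g : {perm 'I_3}) k).
    by move: kj; rewrite -pa_complete_dag inE.
  have := H k j e x y; rewrite /= /zero_label inE pa_complete_dag perm1.
  by move=> H' /eqP/H'; apply.
split; first exact: complete_dag_model.
move=> k j e x y.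
rewrite /= /zero_label inE pa_complete_dag perm1 => /eqP; apply: H.
by rewrite -pa_complete_dag inE.
Qed.

Lemma zero_ldag_conj_dist : ldag_model zero_ldag conj_dist.
Proof.
apply/zero_ldag_modelP => k j x y kj /restr_eqP x0 /restr_eqP eqxy eqk.
apply: eq_kernel_response; rewrite ?perm1 // => eqk2; subst k.
suffices [i [xi yi]]: exists i,
    (i = v0 \/ i = v1) /\ x i = 0%N :> nat /\ y i = 0%N :> nat.
  by rewrite /conj_prob; case: xi => <-; rewrite yi.1 yi.2 ?andbF.
(* The one of [v0], [v1] other than [j] lies in the labeled context, so it is 0 in both outcomes and
   the conjunction fails in both. *)
exists (if j == v0 then v1 else v0).
have in2 : (if j == v0 then v1 else v0) \in before 1%g v2 :\ j.
  have [->|] := eqVneq j v0; rewrite !inE ?v1_before ?v0_before //.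
  by rewrite eq_sym => ->.
rewrite -eqxy // x0 // zero_outcome_val; split=> //; by case: ifP; [right|left].
Qed.

(** * The LDAG of the conjunction is no CStree *)

Lemma v2_last : v2.+1 = nvars three_binary.
Proof. by []. Qed.

Lemma before_neq_v2 j : j \in before 1%g v2 -> v2 != j.
Proof.
by apply: contraTneq => <-; rewrite (before_last _ v2_last) perm1 !inE eqxx.
Qed.

(** The factor 1/4 is the uniform law of (X_0, X_1). *)
Lemma conj_distE x : conj_dist x =
  4^-1 * (if x v2 == 0%N :> nat then conj_prob x else 1 - conj_prob x).
Proof.
rewrite /= !big_ord_recl big_ord0 /response_kernel !perm1 /=.
by case: ifP => _; field.
Qed.

(** When X_2 is last, the order of the other two variables does not affect its kernel. *)
Lemma kernel1_v2 (s : {perm var three_binary}) (P : dist R three_binary) x :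
  s v2 = v2 -> kernel 1%g P v2 x = kernel s P v2 x.
Proof.
move=> s2; rewrite (kernel_last P x v2_last s2).
exact: kernel_last v2_last (perm1 _).
Qed.

Lemma zero_ldag_v2 (P : dist R three_binary) j (v : 'I_2) :
    ldag_model zero_ldag P -> j \in before 1%g v2 ->
  kernel 1%g P v2 (@update three_binary (zero_outcome _) j v)
  = kernel 1%g P v2 (zero_outcome _).
Proof.
move=> /zero_ldag_modelP GP j2; apply: (GP v2 j) => //.
- by rewrite restr_update // !inE eqxx.
- by rewrite restr_update // !inE eqxx.
by rewrite update_other // before_neq_v2.
Qed.

Lemma last_v2_not_csTree (T : csTree three_binary) : st_order T v2 = v2 ->
  ldag_model zero_ldag <> csTree_model T :> classical_sets.set (dist R _).
Proof.
move=> last2 eqGT; pose z := zero_outcome three_binary.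
pose b x := pblock (stages T v2) (restr (before (st_order T) v2) x).
(* A test distribution that isolates the stage of the history 00: it lies in the CStree model, hence
   in the LDAG model, which forces 01 and 10 into that stage. *)
pose h x : R := if b x == b z then 1 / 3 else 2 / 3.
have h_gt0 x : 0 < h x by rewrite /h; case: ifP => _; lra.
have h_lt1 x : h x < 1 by rewrite /h; case: ifP => _; lra.
have h_before x y :
    restr (before (st_order T) v2) x = restr (before (st_order T) v2) y ->
  h x = h y by rewrite /h /b => ->.
have GQ : ldag_model zero_ldag (response_dist h_gt0 h_lt1 h_before).
  rewrite eqGT; apply/csTree_modelP/stagedTree_modelP => k x y.
  move=> /same_stage_pblock eqb eqk.
  by apply: eq_kernel_response eqk _ => eqk; subst k; rewrite /h /b eqb.
have b_update j (v : 'I_2) :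
    j \in before 1%g v2 -> b (@update three_binary z j v) = b z.
  move=> j2; have jv2 := before_neq_v2 j2.
  have := zero_ldag_v2 v GQ j2; rewrite !(kernel1_v2 _ _ last2).
  rewrite !kernel_response_last ?last2 ?update_other ?zero_outcome_val //.
  by rewrite /h eqxx; case: eqP => // _ eq_h; exfalso; clear -eq_h; lra.
have [B TB zB] : exists2 B, B \in stages T v2 & restr _ z \in B.
  have [B TB /andP[zB _]] :=
    (same_stage_pblock (restr _ z) (restr _ z)).2 (erefl (b z)).
  by exists B.
have [S [xS [sSk defB]]] := cst_stages TB.
have in_B x : b x = b z -> restr S x = restr S z.
  move/same_stage_pblock => [C TC /andP[xC zC]].
  have [_ trivT _] := and3P (stages_partition T v2).
  have eqCB : C = B.
    by rewrite -(def_pblock trivT TC zC) (def_pblock trivT TB zB).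
  move: xC zC; rewrite eqCB defB.
  by rewrite !in_stage // => /eqP-> /eqP->.
pose z0 := @update _ z v0 (@Ordinal 2 1 isT).
pose z01 := @update _ z0 v1 (@Ordinal 2 1 isT).
(* Two histories in the cylinder differ at [j], so [j] is not fixed by it. *)
have notinS j : j \in before 1%g v2 -> j \notin S.
  move=> j2; apply/negP => jS.
  have /restr_eqP/(_ j jS) := in_B _ (b_update j (@Ordinal 2 1 isT) j2).
  by move/(congr1 (@nat_of_ord _)); rewrite update_same zero_outcome_val.
(* The cylinder fixes neither X_0 nor X_1, so it also contains the history 11, which [conj_dist]
   separates from 00. *)
have z01B : restr (before (st_order T) v2) z01 \in B.
  move: zB; rewrite defB !in_stage // => /eqP<-.
  apply/eqP; rewrite restr_update ?notinS ?v1_before //.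
  by rewrite restr_update ?notinS ?v0_before.
have TP : csTree_model T conj_dist by rewrite -eqGT; apply: zero_ldag_conj_dist.
have z01_2 : z01 v2 = z v2 by rewrite !update_other.
have zz01 : same_stage (T := T) (k := v2) (restr _ z) (restr _ z01).
  by exists B; rewrite ?zB.
have := (stagedTree_modelP T _).1 ((csTree_modelP T _).1 TP) v2 z z01 zz01.
rewrite last2 z01_2 => /(_ erefl).
rewrite -!(kernel1_v2 _ _ last2) !kernel_response_last ?perm1 ?z01_2;
  rewrite ?zero_outcome_val //.
rewrite /conj_prob !update_val !zero_outcome_val /= => eq_h; clear -eq_h; lra.
Qed.

Lemma last_not_v2_not_csTree (T : csTree three_binary) : st_order T v2 != v2 ->
  ldag_model zero_ldag <> csTree_model T :> classical_sets.set (dist R _).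
Proof.
set s := st_order T => last2 eqGT; pose z := zero_outcome three_binary.
(* Here [v2] is the last position, not the variable X_2: the variable [s v2] is made uniform and
   independent of the rest, which preserves every equality between kernels in a stage. *)
pose f k x : R := if k == v2 then 2^-1 else kernel s conj_dist k x.
have fP : kernel_system s f.
  split=> [k x | k x y eqxy eqk | k x]; rewrite /f; case: (k == v2).
  - lra.
  - exact: kernel_gt0.
  - by [].
  - exact: eq_kernel.
  - by rewrite !big_ord_recl big_ord0; lra.
  - exact: sum_kernel.
have TP : csTree_model T conj_dist by rewrite -eqGT; apply: zero_ldag_conj_dist.
have GQ : ldag_model zero_ldag (kernel_dist fP).
  rewrite eqGT; apply/csTree_modelP/stagedTree_modelP => k x y exy eqk.
  rewrite !kernel_distE /f; case: ifP => _ //.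
  by move/csTree_modelP/stagedTree_modelP: TP; apply.
pose N c x := \sum_(w : 'I_2) conj_dist (@update three_binary x c w).
(* The kernels at the other positions multiply to the marginal of [conj_dist] without [s v2]. *)
have QE x : kernel_dist fP x = 2^-1 * N (s v2) x.
  rewrite -[N _ _](marg_before_last conj_dist x v2_last (erefl (s v2))).
  rewrite [marg _ _ _](chain_rule s conj_dist x (ltnW (ltn_ord v2))) /=.
  rewrite (bigD1 v2) //= {1}/f eqxx; congr (_ * _); apply: eq_big => k.
    by rewrite -val_eqE /= ltn_neqAle -ltnS ltn_ord andbT.
  by rewrite /f => /negbTE->.
have [j [c [j2 eqc eqj]]] : exists j c, [/\ j \in before 1%g v2, s v2 = c &
    (j == v0) && (c == v1) || (j == v1) && (c == v0)].
  have : [|| s v2 == v0, s v2 == v1 | s v2 == v2] by case: (s v2) => -[|[|[|]]].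
  rewrite (negbTE last2) orbF => /orP[] /eqP->.
    by exists v1, v0; rewrite v1_before !eqxx orbT.
  by exists v0, v1; rewrite v0_before !eqxx.
have := zero_ldag_v2 (@Ordinal 2 1 isT) GQ j2.
rewrite !(kernel_last _ _ v2_last (perm1 v2)) !big_ord_recl !big_ord0.
rewrite !QE eqc /N !big_ord_recl !big_ord0 !conj_distE /conj_prob.
rewrite !update_val !zero_outcome_val.
(* Both denominators are the probability 1/4 of a pair (x_0, x_1). Once X_c is averaged out, X_2 = 0
   has probability 1/3 given X_j = 0, but 1/2, the mean of 1/3 and 2/3, given X_j = 1. *)
case/orP: eqj => /andP[/eqP-> /eqP->] /=; clear;
  set d := (X in _ / X = _); set e := (X in _ = _ / X);
  (have -> : d = 4^-1 by rewrite /d; field);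
  (have -> : e = 4^-1 by rewrite /e; field); lra.
Qed.

End Separations.

(** * The chain of strict inclusions *)

Local Open Scope classical_set_scope.

Theorem theorem3p3 (R : realType) :
  DAG_models R `<` CStree_models R /\
  CStree_models R `<` LDAG_models R /\
  LDAG_models R `<` stagedTree_models R.
Proof.
have [T1 T1_dag] := csTree_not_dag R.
have [T3 T3_ldag] := stagedTree_not_ldag R.
split; [| split]; split.
- move=> [V D] [G /= DG]; have [T GT] := dag_csTree R G.
  by exists T; rewrite /= DG GT.
- move=> /(_ (Model (csTree_model T1)))[]; first by exists T1.
  by move=> G; apply: T1_dag.
- move=> [V D] [T /= DT]; have [G TG] := csTree_ldag R T.
  by exists G; rewrite /= DT TG.
- move=> /(_ (Model (ldag_model zero_ldag)))[]; first by exists zero_ldag.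
  move=> T /= GT; have [last2 | last2] := eqVneq (st_order T v2) v2.
    exact: last_v2_not_csTree last2 GT.
  exact: last_not_v2_not_csTree last2 GT.
- move=> [V D] [G /= DG]; have [T GT] := ldag_stagedTree R G.
  by exists T; rewrite /= DG GT.
- move=> /(_ (Model (stagedTree_model T3)))[]; first by exists T3.
  by move=> G; apply: T3_ldag.
Qed.
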